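(* Let $f_2(p)$ be as defined in the context. There exist absolute constants $C>0$ and $x_0>0$ such that for all real $x\ge x_0$, $$\sum_{p<x} f_2(p)\le C\, x\log^2 x\,\log\log x,$$ where the sum runs over prime numbers $p<x$.
   Context: For a positive integer $n$, let $f(n)$ denote the number of ordered triples $(n_1,n_2,n_3)$ of positive integers satisfying $\frac{4}{n}=\frac{1}{n_1}+\frac{1}{n_2}+\frac{1}{n_3}$. For a prime $p$, write $f(p)=f_1(p)+f_2(p)$, where $f_i(p)$ ($i=1,2$) is the number of such solutions $(n_1,n_2,n_3)$ of $\frac{4}{p}=\frac{1}{n_1}+\frac{1}{n_2}+\frac{1}{n_3}$ in which exactly $i$ of the denominators $n_1,n_2,n_3$ are divisible by $p$. *)

(* Defs.v *)
From Stdlib Require Import Reals Lra Lia Arith List ZArith Znumtheory.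
Open Scope R_scope.

Definition is_sol (n : nat) (t : nat * nat * nat) : Prop :=
  let '(n1, n2, n3) := t in
  (0 < n1)%nat /\ (0 < n2)%nat /\ (0 < n3)%nat /\
  4 / INR n = 1 / INR n1 + 1 / INR n2 + 1 / INR n3.

Definition divb (p m : nat) : nat := if Nat.eqb (m mod p) 0 then 1%nat else 0%nat.

Definition is_sol_i (i p : nat) (t : nat * nat * nat) : Prop :=
  is_sol p t /\ let '(n1, n2, n3) := t in (divb p n1 + divb p n2 + divb p n3)%nat = i.

Definition is_count_f (i p c : nat) : Prop :=
  exists l : list (nat * nat * nat),
    NoDup l /\ (forall t, In t l <-> is_sol_i i p t) /\ length l = c.

Definition nat_prime (p : nat) : Prop := prime (Z.of_nat p).

(* Main.v *)
Require Import Defs.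
From Stdlib Require Import Reals List ZArith Znumtheory Lra Lia.
Open Scope R_scope.

(** A solution of [4/p = 1/n1 + 1/n2 + 1/n3] in which [p] divides exactly two
    denominators has, up to order, the form [(a b d, p e d a, p e d b)] with [a], [b]
    coprime, [a + b = e f] and [p = 4 a b d - f].  Fix [a], [b] and a divisor [f] of
    [a + b]: the [d <= D = N / (2 a b)] for which [4 a b d - f] is prime are counted by
    Selberg's upper bound sieve, which gives [O(s(4 a b) D / (1 + log D))] where [s n]
    is the sum of the inverses of the divisors of [n]; note that the bound does not
    depend on [f].  Take [a <= b] and cut [b] into dyadic blocks.  On the block
    [2^i <= b < 2^(i+1)] the mean of [tau (a + b) * s b] over the [b] coprime to [a] is
    [O(i + 1)], because the conditions [f | a + b] and [k | b] confine [b] to one class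
    modulo [f k].  Summing [(i + 3) / (L - i + 1)] over [i <= L], with [L] about
    [log (N / a)], gives [O(log N * log log N)], and the sum of [s a / a] over [a] gives
    the second factor [log N]. *)

(** * Clearing denominators; binary versus natural logarithms *)

Lemma is_sol_nat (p n1 n2 n3 : nat) : (0 < p)%nat -> is_sol p (n1, n2, n3) ->
  (4 * (n1 * n2 * n3) = p * (n2 * n3 + n1 * n3 + n1 * n2))%nat.
Proof.
intros p0 (h1 & h2 & h3 & E).
apply INR_eq; rewrite !mult_INR, !plus_INR, !mult_INR; simpl (INR 4).
apply lt_0_INR in p0, h1, h2, h3.
replace (INR n2 * INR n3 + INR n1 * INR n3 + INR n1 * INR n2)
  with ((1 / INR n1 + 1 / INR n2 + 1 / INR n3) * (INR n1 * INR n2 * INR n3))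
  by (field; lra).
rewrite <- E; field; lra.
Qed.

(** The factor 2 comes from [ln 2 > 1/2]. *)
Lemma pow2_le_ln (k : nat) (y : R) : 2 ^ k <= y -> INR k <= 2 * ln y.
Proof.
intros H; assert (p : 0 < 2 ^ k) by (apply pow_lt; lra).
assert (L : INR k * ln 2 <= ln y).
{ rewrite <- ln_pow by lra; destruct H as [H | H].
  - left; apply ln_increasing; assumption.
  - rewrite H; lra. }
pose proof ln_lt_2; pose proof (pos_INR k); nra.
Qed.

(** Turns a bound in the binary logarithms [l], [l'] into one in [ln x]. The threshold [e^e] gives
    [ln x >= e] and [ln (ln x) >= 1], which absorb the additive constants; 63 is 9 times 7. *)
Lemma log_growth_bound (S N l l' : nat) (K x : R) :
  exp (exp 1) <= x -> INR N < x -> 0 <= K -> 2 ^ l <= INR N -> 2 ^ l' <= INR l + 1 ->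
  INR S <= K * INR N * (INR l + 1) ^ 2 * (INR l' + 1) ->
  INR S <= 63 * K * x * (ln x) ^ 2 * ln (ln x).
Proof.
intros hx Nx K0 hl hl' hS.
assert (e1 : 1 < exp 1) by (pose proof (exp_ineq1 1); lra).
assert (x0 : 0 < x) by (pose proof (exp_pos (exp 1)); lra).
assert (lnx : exp 1 <= ln x).
{ rewrite <- (ln_exp (exp 1)); destruct hx as [hx | hx].
  - left; apply ln_increasing; [apply exp_pos | assumption].
  - rewrite hx; lra. }
assert (llx : 1 <= ln (ln x)).
{ rewrite <- (ln_exp 1); destruct lnx as [lnx | lnx].
  - left; apply ln_increasing; [apply exp_pos | assumption].
  - rewrite <- lnx; lra. }
assert (bl : INR l + 1 <= 3 * ln x) by (pose proof (pow2_le_ln l x); lra).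
(* With [ln 3 < 2], [2 ln (3 ln x) + 1] is at most [5 + 2 ln (ln x)]. *)
assert (bl' : INR l' + 1 <= 7 * ln (ln x)).
{ assert (B : INR l' <= 2 * ln (3 * ln x)) by (apply pow2_le_ln; lra).
  rewrite ln_mult in B by lra.
  assert (ln 3 < 2).
  { rewrite <- (ln_exp 2); apply ln_increasing; [lra |].
    pose proof (exp_ineq1 2); lra. }
  lra. }
pose proof (pos_INR l); pose proof (pos_INR l'); pose proof (pos_INR N).
eapply Rle_trans; [exact hS |].
replace (63 * K * x * ln x ^ 2 * ln (ln x))
  with (K * x * (3 * ln x) ^ 2 * (7 * ln (ln x))) by ring.
apply Rmult_le_compat; [| lra | | exact bl'].
- repeat apply Rmult_le_pos; try apply pow_le; lra.
- apply Rmult_le_compat; [| apply pow_le; lra | | apply pow_incr; lra].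
  + apply Rmult_le_pos; lra.
  + apply Rmult_le_compat_l; lra.
Qed.

From mathcomp Require Import all_boot all_order all_algebra cyclic.
From mathcomp Require Import zify ring lra.
Set Implicit Arguments. Unset Strict Implicit. Unset Printing Implicit Defensive.
Import Order.TTheory GRing.Theory Num.Theory.

Lemma ler_of_eq (F : numDomainType) (x y : F) : x = y -> (x <= y)%R.
Proof. by move=> ->. Qed.

(** * Squarefree numbers *)

Section SquareFree.
Local Open Scope ring_scope.

Definition sqfree (n : nat) : bool :=
  (0 < n)%N && [forall d : 'I_n.+1, (d * d %| n)%N ==> (d == 1 :> nat)].

Lemma sqfreeP (n : nat) :
  reflect ((0 < n)%N /\ forall d : nat, (d * d %| n)%N -> d = 1%N) (sqfree n).
Proof.
apply: (iffP andP) => -[n0 H]; split=> //.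
  move=> d dn; have dd := dvdn_trans (dvdn_mulr d (dvdnn d)) dn.
  have dn1 : (d < n.+1)%N by rewrite ltnS dvdn_leq.
  by have /implyP/(_ dn)/eqP := forallP H (Ordinal dn1).
by apply/forallP => d; apply/implyP => /H ->.
Qed.

Lemma sqfree1 : sqfree 1.
Proof. by apply/sqfreeP; split=> // d; rewrite dvdn1 muln_eq1 => /andP[/eqP]. Qed.

Lemma sqfree_gt0 (n : nat) : sqfree n -> (0 < n)%N.
Proof. by case/andP. Qed.

Lemma sqfree_dvd (m n : nat) : (m %| n)%N -> sqfree n -> sqfree m.
Proof.
move=> mn /sqfreeP[n0 H]; apply/sqfreeP; split; first exact: dvdn_gt0 mn.
by move=> d dm; apply: H; apply: dvdn_trans mn.
Qed.

(** Take the largest [m] with [m^2 | n]: if [d^2] divides the cofactor then [(d m)^2 | n], so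
    [d = 1] by maximality. *)
Lemma sqfree_part (n : nat) : (0 < n)%N ->
  exists k m : nat, [/\ n = (k * (m * m))%N, sqfree k & (0 < m)%N].
Proof.
move=> n0; have ex : exists m : nat, (m * m %| n)%N by exists 1%N.
have bd (m : nat) : (m * m %| n)%N -> (m <= n)%N.
  move=> H; apply: leq_trans (dvdn_leq n0 H).
  by case: m {H} => // m; rewrite leq_pmulr.
case: (ex_maxnP ex bd) => m mn mmax; exists (n %/ (m * m))%N, m.
have m0 : (0 < m)%N by case: m mn {mmax} => //; rewrite dvd0n; lia.
split=> //; first by rewrite divnK.
apply/sqfreeP; split; first by rewrite divn_gt0 ?muln_gt0 ?m0 // dvdn_leq.
move=> d; rewrite dvdn_divRL // => H.
have : (d * m <= m)%N by apply: mmax; rewrite mulnACA.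
have d0 : (0 < d)%N by case: d H => //; rewrite mul0n dvd0n; lia.
by rewrite -[leqRHS]mul1n leq_pmul2r //; lia.
Qed.

End SquareFree.

(** * Reindexing of sums over multiples and divisors *)

Section Reindex.
Local Open Scope ring_scope.
Variable R : nmodType.

Lemma reindex_multiples (d n : nat) (P : pred nat) (g : nat -> R) : (0 < d)%N ->
  \sum_(1 <= j < n.+1 | (d %| j)%N && P j) g j
    = \sum_(1 <= i < (n %/ d).+1 | P (d * i)%N) g (d * i)%N.
Proof.
move=> d0.
rewrite -big_filter -[RHS](big_map (muln d) P g) -[RHS]big_filter.
apply: perm_big; apply: uniq_perm.
- by rewrite filter_uniq // iota_uniq.
- by rewrite filter_uniq // map_inj_uniq ?iota_uniq // => x y /eqP; rewrite eqn_pmul2l // => /eqP.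
move=> x; rewrite !mem_filter mem_index_iota; apply/idP/idP.
  case/andP=> /andP[/dvdnP[y ->] Py] /andP[h1 h2]; rewrite Py /= mulnC map_f //.
  rewrite mem_index_iota; apply/andP; split; first by case: y h1 {Py h2}; lia.
  by rewrite ltnS leq_divRL.
case/andP=> Px /mapP[y]; rewrite mem_index_iota => /andP[h1 h2] E.
rewrite Px {1}E dvdn_mulr //= E muln_gt0 d0 h1 /=.
by rewrite ltnS mulnC -leq_divRL.
Qed.

Lemma sum_nat_widen_vanish (m n : nat) (P : pred nat) (g : nat -> R) : (m <= n)%N ->
  (forall k : nat, (m < k)%N -> P k = false) ->
  \sum_(1 <= k < n.+1 | P k) g k = \sum_(1 <= k < m.+1 | P k) g k.
Proof.
move=> mn H; rewrite (@big_cat_nat _ _ _ m.+1) //=.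
rewrite [X in _ + X]big_nat_cond [X in _ + X]big_pred0 ?addr0 // => k.
by case: (ltnP m k) => // mk; rewrite H // andbF.
Qed.

End Reindex.

(** * The Liouville function *)

Section Liouville.
Local Open Scope ring_scope.
Variable R : pzRingType.

(** As [logn p n] vanishes unless [p] is prime, this is the number of prime factors with
    multiplicity. *)
Definition bigomega (n : nat) : nat := (\sum_(0 <= p < n.+1) logn p n)%N.

Lemma bigomega_widen (m n : nat) : (n <= m)%N ->
  (\sum_(0 <= p < m.+1) logn p n)%N = bigomega n.
Proof.
move=> nm; rewrite /bigomega (@big_cat_nat _ _ _ n.+1) //=.
rewrite [X in (_ + X)%N]big_nat_cond [X in (_ + X)%N]big1 ?addn0 //.
move=> p /andP[/andP[np _] _]; rewrite ltn_log0 //.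
Qed.

Lemma bigomegaM (m n : nat) : (0 < m)%N -> (0 < n)%N ->
  bigomega (m * n) = (bigomega m + bigomega n)%N.
Proof.
move=> m0 n0.
rewrite -(@bigomega_widen (m * n) m) ?leq_pmulr // -(@bigomega_widen (m * n) n) ?leq_pmull //.
by rewrite -big_split; apply: eq_bigr => p _; rewrite lognM.
Qed.

Definition liouville (n : nat) : R := (-1) ^+ bigomega n.

Lemma liouville1 : liouville 1 = 1.
Proof. by rewrite /liouville /bigomega unlock. Qed.

Lemma liouvilleM (m n : nat) : (0 < m)%N -> (0 < n)%N ->
  liouville (m * n) = liouville m * liouville n.
Proof. by move=> m0 n0; rewrite /liouville bigomegaM // exprD. Qed.

Lemma liouville_prime (p : nat) : prime p -> liouville p = -1.
Proof.
move=> pp; rewrite /liouville /bigomega big_nat_recr //= lognE pp prime_gt0 // dvdnn /=.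
rewrite divnn prime_gt0 // logn1 big_nat_cond big1 ?add0n ?expr1 //.
move=> i /andP[/andP[_ ip] _]; apply/eqP; rewrite -leqn0 leqNgt logn_gt0 mem_primes.
by apply/negP => /and3P[pi _]; rewrite dvdn_prime2 // => /eqP E; lia.
Qed.

(* On squarefree numbers the Liouville function agrees with the Moebius function. *)
Lemma sum_liouville (n : nat) : sqfree n ->
  \sum_(1 <= j < n.+1 | (j %| n)%N) liouville j = (n == 1%N)%:R.
Proof.
move=> sn; have n0 := sqfree_gt0 sn.
case: (ltnP 1 n) => [n1|]; last first.
  move=> n1; have -> : n = 1%N by lia.
  by rewrite big_mkcond big_nat1 /= liouville1.
have -> : (n == 1%N) = false by lia.
(* The divisors of [n = p m] pair off as [j] and [p j] with [j | m], of opposite signs. *)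
set p := pdiv n; have pp : prime p by apply: pdiv_prime.
have p0 := prime_gt0 pp.
have pn : (p %| n)%N by apply: pdiv_dvd.
set m := (n %/ p)%N; have nE : n = (p * m)%N by rewrite mulnC /m divnK.
have m0 : (0 < m)%N by move: n0; rewrite nE muln_gt0 => /andP[].
have npm : ~~ (p %| m)%N.
  apply/negP => pm; case/sqfreeP: sn => _ /(_ p); rewrite nE dvdn_pmul2l // => /(_ pm) p1.
  by rewrite p1 in pp.
rewrite (bigID (fun j => p %| j)%N) /=.
have -> : \sum_(1 <= j < n.+1 | (j %| n)%N && (p %| j)%N) liouville j
  = \sum_(1 <= i < m.+1 | (i %| m)%N) (- liouville i).
  rewrite (eq_bigl (fun j => (p %| j)%N && (j %| n)%N)); last by move=> j; rewrite andbC.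
  rewrite reindex_multiples // -/m [LHS]big_nat_cond [RHS]big_nat_cond.
  apply: eq_big => [i|i]; first by rewrite [X in (_ %| X)%N]nE dvdn_pmul2l.
  by case/andP=> /andP[i0 _] _; rewrite liouvilleM // liouville_prime // mulN1r.
rewrite (eq_bigl (fun j => j %| m)%N); last first.
  move=> j; apply/andP/idP => [[jn pj]|jm].
    by rewrite nE Gauss_dvdr // in jn; rewrite coprime_sym prime_coprime.
  split; first by rewrite nE dvdn_mull.
  by apply: contra npm => /dvdn_trans; apply.
rewrite (@sum_nat_widen_vanish _ m n); first by rewrite -big_split /= big1 // => i _; rewrite addNr.
  by rewrite nE leq_pmull.
by move=> k mk; apply/negbTE/negP => /dvdn_leq; lia.
Qed.

End Liouville.

(** * Counting residue classes in intervals *)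

Section ArithmeticProgressions.
Local Open Scope ring_scope.

(** A difference of two integer quotients, stated additively to avoid truncated subtraction. *)
Lemma sum_dvd_shift (lo n c k : nat) : (0 < k)%N ->
  (\sum_(lo.+1 <= d < (lo + n).+1 | k %| d + c) 1 + (lo + c) %/ k = (lo + n + c) %/ k)%N.
Proof.
move=> k0; elim: n => [|n IH]; first by rewrite addn0 big_geq.
rewrite addnS big_mkcond big_nat_recr ?ltnS ?leq_addr //= -big_mkcond /=.
rewrite addnAC IH !addSn divnS // addnC.
by case: (_ %| _)%N.
Qed.

Lemma card_dvd_shift_bounds (lo n c k : nat) : (0 < k)%N ->
  ((\sum_(lo.+1 <= d < (lo + n).+1 | k %| d + c) 1) * k <= n + k)%N /\
  (n <= (\sum_(lo.+1 <= d < (lo + n).+1 | k %| d + c) 1) * k + k)%N.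
Proof.
move=> k0; have := sum_dvd_shift lo n c k0; set s := (X in (X + _)%N).
move=> E; have := divn_eq (lo + c) k; have := divn_eq (lo + n + c) k.
have := ltn_pmod (lo + c) k0; have := ltn_pmod (lo + n + c) k0; rewrite -E mulnDl.
by move: (s * k)%N ((_ %/ _) * _)%N; lia.
Qed.

(** With [v] an inverse of [q] modulo [k], the congruence says that [d] is [v f] modulo [k]; the
    natural number [(k - 1) v f] stands for [- v f]. *)
Lemma modn_dvd_shift (k q f : nat) : (0 < k)%N -> coprime k q ->
  exists c : nat, forall d : nat, (q * d == f %[mod k]) = (k %| d + c)%N.
Proof.
move=> k0 kq.
have [v Hv] : exists v : nat, (q * v = 1 %[mod k])%N.
  (* The number that is 1 modulo [k] and 0 modulo [q] is a multiple of [q]; the quotient is the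
     inverse. *)
  have := chinese_modr kq 1 0; rewrite mod0n => /eqP/dvdnP[v E].
  by exists v; rewrite mulnC -E chinese_modl.
exists ((k - 1) * (v * f))%N => d.
rewrite -(@Gauss_dvdr k q) //.
have E : (q * (d + (k - 1) * (v * f)) = q * d + (k - 1) * f %[mod k])%N.
  rewrite mulnDr -modnDmr -[RHS]modnDmr; congr ((_ + _) %% _)%N.
  rewrite (_ : (q * ((k - 1) * (v * f)) = (q * v) * ((k - 1) * f))%N); last by lia.
  by rewrite -modnMml Hv modnMml mul1n.
rewrite /dvdn E -(eqn_modDr ((k - 1) * f)).
have -> : (f + (k - 1) * f = f * k)%N by case: (k) k0 => // m _; rewrite subn1 /=; lia.
by rewrite modnMl.
Qed.

Lemma card_residue_bounds (k q f D : nat) : (0 < k)%N -> coprime k q ->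
  ((\sum_(1 <= d < D.+1 | q * d == f %[mod k]) 1) * k <= D + k)%N /\
  (D <= (\sum_(1 <= d < D.+1 | q * d == f %[mod k]) 1) * k + k)%N.
Proof.
move=> k0 kq; have [c Hc] := modn_dvd_shift f k0 kq.
by rewrite (eq_bigl _ _ Hc); apply: (card_dvd_shift_bounds 0).
Qed.

End ArithmeticProgressions.

Lemma eqn_mod_lcm (a b k1 k2 : nat) :
  (a == b %[mod lcmn k1 k2]) = (a == b %[mod k1]) && (a == b %[mod k2]).
Proof.
wlog ba : a b / (b <= a)%N.
  by case: (leqP b a) => [|/ltnW] h H; [|rewrite ![(a %% _ == _)%N]eq_sym]; apply: H.
by rewrite !eqn_mod_dvd // dvdn_lcm.
Qed.

(** * Selberg's upper bound sieve *)

Section SelbergSieve.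
Local Open Scope ring_scope.
Variables (F : realFieldType) (q Z : nat).

(** The sieve moduli are prime to [q], so that [q d] is equidistributed modulo [k]. *)
Definition sifting (k : nat) : bool := sqfree k && coprime k q.

Definition selberg_mass : F := \sum_(1 <= l < Z.+1 | sifting l) l%:R^-1.

(* [k * selberg_coeff k] is Selberg's weight [lambda_k]; taking the dual variable
   supported on squarefree [l] with weight [1/l] in place of the optimal [1/phi(l)]
   costs nothing in the main term since [phi l <= l]. *)
Definition selberg_coeff (k : nat) : F :=
  liouville F k * (\sum_(1 <= m < Z.+1 | sifting m && (k %| m)%N) m%:R^-1) / selberg_mass.

Lemma sifting_dvd (m n : nat) : (m %| n)%N -> sifting n -> sifting m.
Proof.
move=> mn /andP[sn cn]; rewrite /sifting (sqfree_dvd mn sn) /=.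
exact: coprime_dvdl cn.
Qed.

Lemma sifting1 : sifting 1.
Proof. by rewrite /sifting sqfree1 coprime1n. Qed.

Hypothesis Z0 : (0 < Z)%N.

Lemma selberg_mass_ge1 : 1 <= selberg_mass.
Proof.
rewrite /selberg_mass big_mkcond big_nat_recl //= sifting1 invr1 lerDl.
by apply: sumr_ge0 => i _; case: ifP => // _; rewrite invr_ge0 ler0n.
Qed.

Lemma selberg_mass_neq0 : selberg_mass != 0.
Proof. by rewrite gt_eqF // (lt_le_trans ltr01 selberg_mass_ge1). Qed.

Lemma selberg_coeff1 : selberg_coeff 1 = 1.
Proof.
rewrite /selberg_coeff liouville1 mul1r (eq_bigl sifting) => [|k].
  by rewrite -/selberg_mass divff // selberg_mass_neq0.
by rewrite dvd1n andbT.
Qed.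

(** The inner sum keeps only some of the nonnegative terms of the mass. *)
Lemma normr_selberg_coeff (k : nat) : `|selberg_coeff k| <= 1.
Proof.
rewrite /selberg_coeff !normrM normfV /liouville normrX normrN1 expr1n mul1r.
have G1 := selberg_mass_ge1; have G0 : 0 < selberg_mass by apply: lt_le_trans G1.
rewrite (ger0_norm (ltW G0)) ler_pdivrMr // mul1r.
have H (P : pred nat) : 0 <= \sum_(1 <= m < Z.+1 | P m) (m%:R^-1 : F).
  by apply: sumr_ge0 => i _; rewrite invr_ge0 ler0n.
rewrite ger0_norm // /selberg_mass [leRHS](bigID (fun m => k %| m)%N) /= lerDl.
exact: H.
Qed.

(** If [l | m], writing [k = l i] leaves the sum of the Liouville function over the divisors of the
    squarefree [m / l], which vanishes unless [m = l]; otherwise the sum is empty. *)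
Lemma sum_liouville_between (l m : nat) : (0 < l)%N -> sifting m -> (m <= Z)%N ->
  \sum_(1 <= k < Z.+1 | sifting k && (l %| k)%N && (k %| m)%N) liouville F k
    = (m == l)%:R * liouville F l.
Proof.
move=> l0 sm mZ; have [sqm cm] := andP sm; have m0 := sqfree_gt0 sqm.
rewrite (eq_bigl (fun k => (l %| k) && (k %| m))%N); last first.
  move=> k; case km: (k %| m)%N; rewrite ?andbF ?andbT //.
  by rewrite (sifting_dvd km sm).
rewrite reindex_multiples //.
case lm: (l %| m)%N; last first.
  rewrite big_pred0 => [|i].
    by case: eqP lm => [->|_ _]; rewrite ?dvdnn // mul0r.
  by apply/negP => /(dvdn_trans (dvdn_mulr i (dvdnn l))); rewrite lm.
have [w wE] := dvdnP lm; rewrite mulnC in wE.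
have w0 : (0 < w)%N by case: w wE m0 => //; lia.
rewrite (@sum_nat_widen_vanish _ w).
- rewrite (eq_bigl (fun i => i %| w)%N) => [|i]; last by rewrite wE dvdn_pmul2l.
  rewrite big_nat_cond (eq_bigr (fun i => liouville F l * liouville F i)) => [|i /andP[/andP[i0 _] _]].
    rewrite -big_nat_cond -big_distrr /= sum_liouville; last first.
      by apply: sqfree_dvd sqm; rewrite wE dvdn_mull.
    rewrite mulrC wE; congr (_%:R * _); congr nat_of_bool.
    by rewrite -{2}(muln1 l) eqn_pmul2l.
  by rewrite liouvilleM.
- by rewrite leq_divRL // mulnC -wE.
- by move=> k wk; apply/negbTE/negP; rewrite wE dvdn_pmul2l // => /dvdn_leq; lia.
Qed.

(** Moebius inversion: after exchanging the sums only [m = l] survives. These are the variables that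
    diagonalise the quadratic form. *)
Lemma sum_selberg_coeff_multiples (l : nat) : sifting l -> (0 < l <= Z)%N ->
  \sum_(1 <= k < Z.+1 | sifting k && (l %| k)%N) selberg_coeff k
    = liouville F l / (l%:R * selberg_mass).
Proof.
move=> sl /andP[l0 lZ].
rewrite /selberg_coeff -big_distrl /= invfM mulrA; congr (_ / _).
under eq_bigr => k _ do rewrite big_distrr big_mkcond /=.
have inner (m : nat) : (m <= Z)%N -> \sum_(1 <= k < Z.+1 | sifting k && (l %| k)%N)
    (if sifting m && (k %| m)%N then liouville F k * m%:R^-1 else 0)
    = if sifting m then (m == l)%:R * liouville F l * m%:R^-1 else 0.
  move=> mZ; case sm: (sifting m); last by rewrite big1.
  by rewrite -sum_liouville_between // big_distrl /= -big_mkcondr.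
rewrite exchange_big /= (bigD1_seq l) ?mem_index_iota ?l0 ?iota_uniq //= inner // sl eqxx mul1r.
rewrite [X in _ + X]big_nat_cond [X in _ + X]big1 ?addr0 // => m /andP[/andP[_ mZ] ml].
by rewrite inner // (negbTE ml) !mul0r if_same.
Qed.

(** The gcd is the sum of [totient] over its divisors, and every divisor of [k1] is a sieve modulus
    at most [Z]. *)
Lemma sum_totient_common (k1 k2 : nat) : (0 < k1 <= Z)%N -> sifting k1 -> (0 < k2)%N ->
  \sum_(1 <= l < Z.+1 | sifting l)
     (totient l)%:R * ((l %| k1)%N)%:R * ((l %| k2)%N)%:R = (gcdn k1 k2)%:R :> F.
Proof.
move=> /andP[k10 k1Z] s1 k20.
have g0 : (0 < gcdn k1 k2)%N by rewrite gcdn_gt0 k10.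
rewrite -[in RHS](sum_totient_dvd (gcdn k1 k2)) natr_sum.
rewrite -(big_mkord (fun d => d %| gcdn k1 k2)%N (fun d => (totient d)%:R)).
rewrite big_ltn_cond // dvd0n gtn_eqF //.
rewrite -(@sum_nat_widen_vanish _ _ Z (fun d => d %| gcdn k1 k2)%N); first last.
- by move=> k gk; apply/negbTE/negP => /dvdn_leq; lia.
- by apply: leq_trans k1Z; rewrite dvdn_leq // dvdn_gcdl.
rewrite big_mkcond [RHS]big_mkcond; apply: eq_bigr => l _.
rewrite dvdn_gcd; case l1: (l %| k1)%N; last by rewrite mulr0 mul0r if_same.
by rewrite (sifting_dvd l1 s1); case: (l %| k2)%N; rewrite !mulr1 ?mulr0.
Qed.

(** Expanding the gcd by totients gives the sum of [totient l] times [y_l^2], where [y_l] is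
    [1 / (l G)] up to sign and [G] is the mass. Since [totient l <= l], this is at most
    [G / G^2]. *)
Lemma selberg_form :
  \sum_(1 <= k1 < Z.+1 | sifting k1) \sum_(1 <= k2 < Z.+1 | sifting k2)
    selberg_coeff k1 * selberg_coeff k2 * (gcdn k1 k2)%:R <= selberg_mass^-1.
Proof.
have G0 := selberg_mass_neq0.
have -> : \sum_(1 <= k1 < Z.+1 | sifting k1) \sum_(1 <= k2 < Z.+1 | sifting k2)
    selberg_coeff k1 * selberg_coeff k2 * (gcdn k1 k2)%:R
  = \sum_(1 <= l < Z.+1 | sifting l) (totient l)%:R *
      (\sum_(1 <= k < Z.+1 | sifting k && (l %| k)%N) selberg_coeff k) ^+ 2.
  under [RHS]eq_bigr => l _ do rewrite expr2 big_mkcondr big_distrlr big_distrr /=.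
  rewrite [RHS]exchange_big /=; rewrite big_nat_cond [RHS]big_nat_cond.
  apply: eq_bigr => k1 /andP[k1Z s1].
  under [RHS]eq_bigr => l _ do rewrite big_distrr /=.
  rewrite [RHS]exchange_big /=; rewrite big_nat_cond [RHS]big_nat_cond.
  apply: eq_bigr => k2 /andP[/andP[k20 _] s2].
  rewrite -sum_totient_common // big_distrr /=; apply: eq_bigr => l _.
  by case: (l %| k1)%N; case: (l %| k2)%N; rewrite ?mulr1 ?mulr0 ?mul0r ?mulr0 // mulrC.
have -> : selberg_mass^-1 = selberg_mass * (selberg_mass * selberg_mass)^-1.
  by rewrite invfM mulVKf.
rewrite {1}/selberg_mass big_distrl /=.
rewrite big_nat_cond [leRHS]big_nat_cond; apply: ler_sum => l /andP[lZ sl].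
rewrite sum_selberg_coeff_multiples // expr_div_n /liouville -exprM mulnC exprM sqrrN !expr1n.
have l0 : (0 : F) < l%:R by rewrite ltr0n; case/andP: lZ.
rewrite div1r exprMn invfM mulrA -[selberg_mass * _]expr2.
rewrite ler_wpM2r ?invr_ge0 ?sqr_ge0 //.
rewrite ler_pdivrMr ?exprn_gt0 // expr2 mulKf ?gt_eqF // ler_nat.
rewrite totient_count_coprime -[leqRHS]subn0 -[leqRHS]muln1 -sum_nat_const_nat.
by apply: leq_sum => d _; apply: leq_b1.
Qed.

(** The congruence means [k | P]; as [k <= Z < P], only [k = 1] contributes. *)
Lemma sum_selberg_prime_gt (P n f : nat) : prime P -> (Z < P)%N -> (P + f)%N = n ->
  \sum_(1 <= k < Z.+1 | sifting k)
     ((n == f %[mod k])%N)%:R * (k%:R * selberg_coeff k) = 1.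
Proof.
move=> pP ZP E; rewrite big_ltn_cond // sifting1 !modn1 eqxx !mul1r selberg_coeff1.
rewrite big_nat_cond big1 ?addr0 // => k /andP[/andP[k1 kZ] _].
rewrite eqn_mod_dvd -E ?leq_addl // addnK.
case kP: (k %| P)%N; last by rewrite mul0r.
by case/primeP: pP => _ /(_ k kP) /orP[] /eqP; lia.
Qed.

Lemma sum_id_le_sqr (n : nat) : \sum_(1 <= k < n.+1) (k%:R : F) <= (n ^ 2)%:R.
Proof.
rewrite -natr_sum ler_nat.
apply: (@leq_trans (\sum_(1 <= k < n.+1) n)).
  by rewrite big_nat_cond [leqRHS]big_nat_cond; apply: leq_sum => k; lia.
by rewrite sum_nat_const_nat; lia.
Qed.

(** The indicator of primes above [Z] is majorised by the square of the weighted sum, which is 1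
    there. On expanding, [k1] and [k2] impose one congruence modulo their lcm; [k1 k2 / lcm = gcd]
    produces the quadratic form, and the errors total at most the square of the sum of the [k],
    hence [Z^4]. *)
Lemma selberg_sieve (f D : nat) :
  (\sum_(1 <= d < D.+1 | prime (q * d - f) && (Z < q * d - f)%N) 1)%N%:R
    <= D%:R / selberg_mass + (Z ^ 4)%:R.
Proof.
pose c k : F := k%:R * selberg_coeff k.
pose e k d : F := ((q * d == f %[mod k])%N)%:R.
apply: (@le_trans _ _ (\sum_(1 <= d < D.+1) (\sum_(1 <= k < Z.+1 | sifting k) e k d * c k) ^+ 2)).
  rewrite natr_sum big_mkcond; apply: ler_sum => d _.
  case: ifP => [/andP[pP ZP]|_]; last exact: sqr_ge0.
  rewrite (sum_selberg_prime_gt pP ZP) ?expr1n // subnK //.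
  (* The subtraction is truncated, but a prime value excludes [q d < f]. *)
  by case: (leqP f (q * d)) pP => // /ltnW; rewrite -subn_eq0 => /eqP ->.
apply: (@le_trans _ _ (\sum_(1 <= k1 < Z.+1 | sifting k1) \sum_(1 <= k2 < Z.+1 | sifting k2)
    (D%:R * (selberg_coeff k1 * selberg_coeff k2 * (gcdn k1 k2)%:R) + k1%:R * k2%:R))).
  under eq_bigr => d _ do rewrite expr2 big_distrlr /=.
  rewrite exchange_big /= big_nat_cond [leRHS]big_nat_cond.
  apply: ler_sum => k1 /andP[/andP[k10 _] /andP[_ c1]].
  rewrite exchange_big /= big_nat_cond [leRHS]big_nat_cond.
  apply: ler_sum => k2 /andP[/andP[k20 _] /andP[_ c2]].
  have l0 : (0 < lcmn k1 k2)%N by rewrite lcmn_gt0 k10.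
  have cl : coprime (lcmn k1 k2) q by apply: (@coprime_dvdl _ (k1 * k2)); rewrite ?coprimeMl ?c1 ?c2 // dvdn_lcm dvdn_mulr // dvdn_mull.
  have [ub lb] := card_residue_bounds f D l0 cl.
  under eq_bigr => d _ do rewrite mulrACA -natrM mulnb -eqn_mod_lcm.
  rewrite -big_distrl /= -natr_sum.
  have -> : (\sum_(1 <= d < D.+1) (q * d == f %[mod lcmn k1 k2]))%N
     = (\sum_(1 <= d < D.+1 | q * d == f %[mod lcmn k1 k2]) 1)%N.
    by rewrite [RHS]big_mkcond; apply: eq_bigr => d _; case: eqP.
  move: ub lb; set n := (\sum_(_ <= _ < _ | _) _)%N.
  rewrite -(ler_nat F) natrD natrM => ub; rewrite -(ler_nat F) natrD natrM => lb.
  have E : (k1%:R * k2%:R : F) = (lcmn k1 k2)%:R * (gcdn k1 k2)%:R by rewrite -!natrM muln_lcm_gcd.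
  have g0 : 0 <= (gcdn k1 k2)%:R :> F by rewrite ler0n.
  rewrite /c mulrACA E; move: (gcdn k1 k2)%:R g0 => g g0.
  have x1 := normr_selberg_coeff k1; have x2 := normr_selberg_coeff k2.
  have x12 : `|selberg_coeff k1 * selberg_coeff k2| <= 1 by rewrite normrM mulr_ile1.
  move: (selberg_coeff k1 * selberg_coeff k2) x12 => x x12.
  (* Multiplied by the gcd, this error is at most [k1 k2]. *)
  have dist : `|n%:R * (lcmn k1 k2)%:R - D%:R| <= (lcmn k1 k2)%:R :> F.
    by rewrite ler_norml; apply/andP; split; lra.
  move: (lcmn k1 k2)%:R dist => L dist.
  have -> : n%:R * (L * g * x) = (n%:R * L - D%:R) * x * g + D%:R * (x * g) by ring.
  rewrite addrC lerD2l; apply: ler_wpM2r => //.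
  apply: le_trans (ler_norm _) _; rewrite normrM -[leRHS]mulr1.
  exact: ler_pM.
under eq_bigr => k1 _ do rewrite big_split /= -big_distrr -big_distrr /=.
rewrite big_split /= -big_distrr -big_distrl /= lerD //.
  by rewrite ler_wpM2l ?ler0n // selberg_form.
rewrite (_ : 4 = 2 + 2)%N // expnD natrM.
have H : \sum_(1 <= k < Z.+1 | sifting k) (k%:R : F) <= (Z ^ 2)%:R.
  apply: le_trans (sum_id_le_sqr Z).
  rewrite big_mkcond; apply: ler_sum => k _; case: ifP => // _; exact: ler0n.
by apply: ler_pM => //; apply: sumr_ge0 => k _; exact: ler0n.
Qed.

End SelbergSieve.

(** * Harmonic sums and sums of inverse divisors *)

Section Harmonic.
Local Open Scope ring_scope.
Variable F : realFieldType.

Definition harmonic (n : nat) : F := \sum_(1 <= k < n.+1) k%:R^-1.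

(** The classical [sigma(n) / n]; it bounds the loss from keeping only moduli prime to [n]. *)
Definition sum_inv_divisors (n : nat) : F :=
  \sum_(1 <= k < n.+1 | (k %| n)%N) k%:R^-1.

Lemma sum_inv_ge0 (r : seq nat) (P : pred nat) (h : nat -> nat) :
  0 <= \sum_(k <- r | P k) (h k)%:R^-1 :> F.
Proof. by apply: sumr_ge0 => k _; rewrite invr_ge0 ler0n. Qed.

Lemma harmonic_le (m n : nat) : (m <= n)%N -> harmonic m <= harmonic n.
Proof.
move=> mn; rewrite /harmonic [leRHS](@big_cat_nat _ _ _ m.+1) //= lerDl.
exact: (sum_inv_ge0 _ _ id).
Qed.

Lemma harmonic_ge1 (n : nat) : (0 < n)%N -> 1 <= harmonic n.
Proof. by move=> n0; apply: le_trans (harmonic_le n0); rewrite /harmonic big_nat1 invr1. Qed.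

Lemma sum_inv_dyadic_le1 (i : nat) :
  \sum_(2 ^ i <= k < 2 ^ i.+1) (k%:R^-1 : F) <= 1.
Proof.
have p0 : (0 : F) < (2 ^ i)%:R by rewrite ltr0n expn_gt0.
apply: (@le_trans _ _ (\sum_(2 ^ i <= k < 2 ^ i.+1) (2 ^ i)%:R^-1)).
  rewrite big_nat_cond [leRHS]big_nat_cond; apply: ler_sum => k /andP[/andP[k1 k2] _].
  have k0 : (0 < k)%N by apply: leq_trans k1; rewrite expn_gt0.
  by rewrite lef_pV2 ?posrE ?ltr0n ?expn_gt0 // ler_nat.
by rewrite sumr_const_nat expnS mul2n -addnn addnK -[leLHS]mulr_natl divff ?gt_eqF.
Qed.

(** Each doubling of the range adds [2^i] terms, none below [1 / 2^(i+1)]. *)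
Lemma harmonic_pow2_ge (i : nat) : 1 + i%:R / 2 <= harmonic (2 ^ i).
Proof.
elim: i => [|i IH]; first by rewrite mul0r addr0 harmonic_ge1.
rewrite -natr1 mulrDl addrA; apply: (le_trans (lerD IH (lexx _))).
rewrite /harmonic [leRHS](@big_cat_nat _ _ _ (2 ^ i).+1) //= ?ltnS ?leq_exp2l // lerD2l.
apply: (@le_trans _ _ (\sum_((2 ^ i).+1 <= k < (2 ^ i.+1).+1) (2 ^ i.+1)%:R^-1)).
  rewrite sumr_const_nat subSS [in (_ - _)%N]expnS mul2n -addnn addnK -[leRHS]mulr_natl.
  rewrite expnS natrM invfM mulrCA divff ?mulr1 ?mul1r //.
  by rewrite pnatr_eq0 -lt0n expn_gt0.
apply: ler_sum_nat => k /andP[k1 k2].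
have k0 : (0 < k)%N by apply: leq_ltn_trans k1.
by rewrite lef_pV2 ?posrE ?ltr0n ?expn_gt0 // ler_nat.
Qed.

Lemma harmonic_le_trunc_log (n : nat) : harmonic n <= (trunc_log 2 n).+1%:R.
Proof.
have H i : \sum_(1 <= k < 2 ^ i) (k%:R^-1 : F) <= i%:R.
  elim: i => [|i IH]; first by rewrite big_geq.
  rewrite (@big_cat_nat _ _ _ (2 ^ i)) ?expn_gt0 //= ?leq_exp2l //.
  by rewrite -natr1 lerD // sum_inv_dyadic_le1.
apply: le_trans (H _).
rewrite [leRHS](@big_cat_nat _ _ _ n.+1) //= ?trunc_log_ltn // lerDl.
exact: (sum_inv_ge0 _ _ id).
Qed.

Lemma sum_inv_sqr_le2 (n : nat) : \sum_(1 <= k < n.+1) ((k * k)%N%:R^-1 : F) <= 2.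
Proof.
(* The sharper bound [2 - 1/n] makes the induction go through. *)
suff H : (0 < n)%N -> \sum_(1 <= k < n.+1) ((k * k)%N%:R^-1 : F) <= 2 - n%:R^-1.
  case: n H => [_|n /(_ isT) H]; first by rewrite big_geq.
  by apply: le_trans H _; rewrite lerBlDr lerDl invr_ge0 ler0n.
elim: n => // -[_ _|n /(_ isT) IH _]; first by rewrite big_nat1 invr1; lra.
rewrite big_nat_recr //=; apply: le_trans (lerD IH (lexx _)) _.
have a0 : (0 : F) < n.+1%:R by rewrite ltr0n.
rewrite natrM -[n.+2%:R]natr1; move: (n.+1%:R : F) a0 => a a0.
have -> : 2 - a^-1 + ((a + 1) * (a + 1))^-1 = 2 - (a + 1)^-1 - (a * (a + 1) * (a + 1))^-1.
  by field; apply/andP; split; lra.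
by rewrite gerDl oppr_le0 invr_ge0 !mulr_ge0 //; lra.
Qed.

(** Every [1/n] occurs among the nonnegative terms [1 / (i h(j))] of the expanded product, and
    different [n] use different terms. It is applied with [h] the square and with [h] the
    identity. *)
Lemma sum_inv_le_mul (N A B : nat) (P Q1 Q2 : pred nat) (h : nat -> nat) :
  (forall n : nat, (0 < n <= N)%N -> P n -> exists i j : nat,
     [/\ n = (i * h j)%N, (0 < i <= A)%N && Q1 i & (0 < j <= B)%N && Q2 j]) ->
  \sum_(1 <= n < N.+1 | P n) (n%:R^-1 : F)
    <= (\sum_(1 <= i < A.+1 | Q1 i) i%:R^-1) * (\sum_(1 <= j < B.+1 | Q2 j) (h j)%:R^-1).
Proof.
move=> H; rewrite big_distrlr /=.
apply: (@le_trans _ _ (\sum_(1 <= n < N.+1 | P n) \sum_(1 <= i < A.+1 | Q1 i)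
   \sum_(1 <= j < B.+1 | Q2 j) (if n == (i * h j)%N then (i * h j)%N%:R^-1 else 0))).
  rewrite big_nat_cond [leRHS]big_nat_cond; apply: ler_sum => n /andP[nN Pn].
  have [i [j [E /andP[iA Q1i] /andP[jB Q2j]]]] := H n nN Pn.
  have t0 i' j' : 0 <= (if n == (i' * h j')%N then (i' * h j')%N%:R^-1 else 0) :> F.
    by case: ifP => // _; rewrite invr_ge0 ler0n.
  rewrite big_mkcond (bigD1_seq i) ?mem_index_iota ?iota_uniq //= Q1i.
  rewrite -[leLHS]addr0 lerD //; last first.
    by apply: sumr_ge0 => i' _; case: ifP => // _; apply: sumr_ge0 => j' _; apply: t0.
  rewrite big_mkcond (bigD1_seq j) ?mem_index_iota ?iota_uniq //= Q2j E eqxx.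
  by rewrite lerDl; apply: sumr_ge0 => j' _; case: ifP => // _; rewrite -E; apply: t0.
rewrite exchange_big /=; apply: ler_sum => i _.
rewrite exchange_big /=; apply: ler_sum => j _; rewrite -invfM -natrM; set c := (i * h j)%N.
case: (boolP (c \in index_iota 1 N.+1)) => [cN|cN].
  rewrite big_mkcond (bigD1_seq c) ?iota_uniq //= eqxx big1 ?addr0.
    by case: ifP => // _; rewrite invr_ge0 ler0n.
  by move=> n /negbTE ->; rewrite if_same.
rewrite big_seq_cond big1 ?invr_ge0 ?ler0n // => n /andP[nN _].
by case: eqP => // E; rewrite -E nN in cN.
Qed.

(** Each number is a squarefree number times a square, and the inverse squares sum to at most 2. *)
Lemma harmonic_le_sqfree (n : nat) :
  harmonic n <= 2 * \sum_(1 <= k < n.+1 | sqfree k) k%:R^-1.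
Proof.
apply: (@le_trans _ _ ((\sum_(1 <= k < n.+1 | sqfree k) k%:R^-1)
    * (\sum_(1 <= j < n.+1 | predT j) (j * j)%N%:R^-1))).
  apply: sum_inv_le_mul => m /andP[m0 mn] _; have [k [j [E sk j0]]] := sqfree_part m0.
  have k0 := sqfree_gt0 sk; exists k, j; rewrite E sk k0 j0 !andbT; split=> //=.
    by apply: leq_trans mn; rewrite E leq_pmulr // muln_gt0 j0.
  by apply: leq_trans mn; rewrite E mulnA leq_pmull // muln_gt0 k0.
by rewrite mulrC ler_wpM2r ?(sum_inv_ge0 _ _ id) // sum_inv_sqr_le2.
Qed.

(** A squarefree [k] is [gcd(k, q)], a divisor of [q], times a cofactor prime to [q]. *)
Lemma sum_inv_sqfree_le (q Z : nat) : (0 < q)%N ->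
  \sum_(1 <= k < Z.+1 | sqfree k) (k%:R^-1 : F)
    <= sum_inv_divisors q * selberg_mass F q Z.
Proof.
move=> q0; apply: (@sum_inv_le_mul _ _ _ _ _ _ id) => k /andP[k0 kZ] sk.
have g0 : (0 < gcdn k q)%N by rewrite gcdn_gt0 k0.
exists (gcdn k q), (k %/ gcdn k q)%N; split.
- by rewrite mulnC divnK // dvdn_gcdl.
- by rewrite g0 dvdn_gcdr dvdn_leq // dvdn_gcdr.
rewrite divn_gt0 // dvdn_leq ?dvdn_gcdl //= (leq_trans (leq_div _ _)) //=.
have E := divnK (dvdn_gcdl k q).
rewrite /sifting (sqfree_dvd _ sk) /=; last by rewrite dvdn_div ?dvdn_gcdl.
(* A common factor of the cofactor and [q] also divides the gcd, so its square divides [k]. *)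
case/sqfreeP: sk => _ sk; apply/eqP; apply: sk.
set r := gcdn _ q; have rq : (r %| q)%N by apply: dvdn_gcdr.
have rk : (r %| k %/ gcdn k q)%N by apply: dvdn_gcdl.
have rg : (r %| gcdn k q)%N by rewrite dvdn_gcd rq andbT (dvdn_trans rk) // dvdn_div ?dvdn_gcdl.
by apply: dvdn_trans (dvdn_mul rk rg) _; rewrite E.
Qed.

(** Supplies the lower bound for the sieve mass, of order [log Z / s(q)]. *)
Lemma harmonic_le_selberg_mass (q Z : nat) : (0 < q)%N ->
  harmonic Z <= 2 * sum_inv_divisors q * selberg_mass F q Z.
Proof.
move=> q0; apply: le_trans (harmonic_le_sqfree Z) _; rewrite -mulrA.
by rewrite ler_wpM2l // sum_inv_sqfree_le.
Qed.

(** A divisor [n] of [a b] is [gcd(n, a)] times a cofactor that divides [b]. *)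
Lemma sum_inv_divisorsM (a b : nat) : (0 < a)%N -> (0 < b)%N ->
  sum_inv_divisors (a * b) <= sum_inv_divisors a * sum_inv_divisors b.
Proof.
move=> a0 b0; apply: (@sum_inv_le_mul _ _ _ _ _ _ id) => n /andP[n0 nab] ndvd.
have g0 : (0 < gcdn n a)%N by rewrite gcdn_gt0 n0.
have E := divnK (dvdn_gcdl n a).
have nb : (n %/ gcdn n a %| b)%N.
  rewrite -(@Gauss_dvdr _ (a %/ gcdn n a)).
    by rewrite -(dvdn_pmul2r g0) E mulnAC divnK ?dvdn_gcdr.
  by rewrite /coprime -(eqn_pmul2r g0) muln_gcdl E divnK ?dvdn_gcdr // mul1n.
exists (gcdn n a), (n %/ gcdn n a)%N; split.
- by rewrite mulnC E.
- by rewrite g0 dvdn_gcdr dvdn_leq // dvdn_gcdr.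
- by rewrite nb divn_gt0 // (dvdn_leq b0 nb) dvdn_leq // dvdn_gcdl.
Qed.

Lemma sum_inv_divisors_ge1 (n : nat) : (0 < n)%N -> 1 <= sum_inv_divisors n.
Proof.
move=> n0; rewrite /sum_inv_divisors big_ltn_cond // dvd1n invr1 lerDl.
exact: (sum_inv_ge0 _ _ id).
Qed.

(** For a divisor [k] of [a = k i], the term [1 / (k a)] is [1 / (k^2 i)]. *)
Lemma sum_inv_divisors_avg (A : nat) :
  \sum_(1 <= a < A.+1) sum_inv_divisors a / a%:R <= 2 * harmonic A.
Proof.
apply: (@le_trans _ _ (\sum_(1 <= a < A.+1) \sum_(1 <= k < A.+1 | (k %| a)%N) k%:R^-1 / a%:R)).
  rewrite big_nat_cond [leRHS]big_nat_cond; apply: ler_sum => a /andP[/andP[a0 aA] _].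
  rewrite /sum_inv_divisors (@sum_nat_widen_vanish _ a A) //; first by rewrite big_distrl.
  by move=> k ak; apply/negbTE/negP => /dvdn_leq; lia.
under eq_bigr => a _ do rewrite big_mkcond /=.
rewrite exchange_big /=.
apply: (@le_trans _ _ (\sum_(1 <= k < A.+1) ((k * k)%N%:R^-1 * harmonic A))).
  rewrite big_nat_cond [leRHS]big_nat_cond; apply: ler_sum => k /andP[/andP[k0 kA] _].
  rewrite -big_mkcond /= (eq_bigl (fun a => (k %| a) && predT a)%N) => [|a]; last by rewrite andbT.
  rewrite reindex_multiples //.
  rewrite (eq_bigr (fun i => (k * k)%N%:R^-1 * i%:R^-1)) => [|i _]; last first.
    by rewrite -!invfM -!natrM mulnA.
  rewrite -big_distrr /= ler_wpM2l ?invr_ge0 ?ler0n //.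
  by apply: harmonic_le; apply: leq_div.
by rewrite -big_distrl /= ler_wpM2r ?sum_inv_sqr_le2 // (sum_inv_ge0 _ _ id).
Qed.

End Harmonic.

(** * Primes in arithmetic progressions *)

Section PrimesInProgressions.
Local Open Scope ring_scope.
Variable F : realFieldType.

Definition prime_count (q f D : nat) : nat :=
  (\sum_(1 <= d < D.+1 | prime (q * d - f)) 1)%N.

(** The sieve misses the primes up to [Z]; since [2 f <= q] gives [d <= q d - f], these come from at
    most [Z] values of [d]. *)
Lemma prime_count_le_selberg (q f D Z : nat) : (0 < Z <= D)%N -> (0 < q)%N -> (2 * f <= q)%N ->
  (prime_count q f D)%:R <= D%:R / selberg_mass F q Z + (Z + Z ^ 4)%:R.
Proof.
move=> /andP[Z0 ZD] q0 fq; rewrite natrD addrCA.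
apply: le_trans (lerD (lexx _) (selberg_sieve F q Z0 f D)).
rewrite -natrD ler_nat /prime_count (bigID (fun d => Z < q * d - f)%N) /= addnC leq_add2r.
apply: (@leq_trans (\sum_(1 <= d < D.+1 | (d <= Z)%N) 1)%N).
  rewrite big_nat_cond big_mkcond [leqRHS]big_nat_cond [leqRHS]big_mkcond; apply: leq_sum => d _.
  case: ifP => // /andP[/andP[d1 dD] /andP[_ H]].
  suff -> : (d <= Z)%N by rewrite d1 dD.
  by rewrite -leqNgt in H; apply: leq_trans H; nia.
rewrite (@sum_nat_widen_vanish _ Z) // => [|k]; last by rewrite ltnNge => /negbTE.
rewrite big_mkcond.
apply: (@leq_trans (\sum_(1 <= k < Z.+1) 1)%N); last by rewrite sum_nat_const_nat; lia.
by apply: leq_sum => k _; case: ifP.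
Qed.

Lemma prime_count_le (q f D : nat) : (0 < D)%N -> (0 < q)%N -> (2 * f <= q)%N ->
  (prime_count q f D)%:R
    <= 48 * sum_inv_divisors F q * D%:R / (trunc_log 2 D).+1%:R.
Proof.
(* This level gives [Z^8 <= D], so [Z + Z^4] stays [O(D)] even after multiplication by [L + 1]. *)
move=> D0 q0 fq; set L := trunc_log 2 D; pose i := (L %/ 8)%N; pose Z := (2 ^ i)%N.
have Z0 : (0 < Z)%N by rewrite expn_gt0.
have L8 : (L.+1 <= 8 * i.+1)%N by have := divn_eq L 8; have := ltn_pmod L (isT : 0 < 8)%N; lia.
have Z8 : (Z ^ 4 * Z ^ 4 <= D)%N.
  rewrite -expnD -expnM; apply: leq_trans (trunc_logP (isT : 1 < 2)%N D0).
  by rewrite leq_exp2l // leq_divM.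
have ZZ4 : (Z <= Z ^ 4)%N by rewrite -{1}(expn1 Z) leq_pexp2l.
have ZD : (0 < Z <= D)%N.
  by rewrite Z0 (leq_trans ZZ4) // (leq_trans _ Z8) // leq_pmulr // expn_gt0 Z0.
have iZ : (i.+1 <= Z)%N by apply: ltn_expl.
have ZL : ((Z + Z ^ 4) * L.+1 <= 16 * D)%N.
  apply: (@leq_trans ((2 * Z ^ 4) * (8 * Z ^ 4))%N); last by lia.
  by apply: leq_mul; lia.
apply: le_trans (prime_count_le_selberg ZD q0 fq) _.
have G1 := selberg_mass_ge1 F q Z0; have s1 := sum_inv_divisors_ge1 F q0.
have H1 := harmonic_pow2_ge F i; have H2 := harmonic_le_selberg_mass F Z q0.
have L0 : (0 : F) < L.+1%:R by rewrite ltr0n.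
move: L8 ZL; rewrite -(ler_nat F) natrM -[i.+1%:R]natr1 => L8.
rewrite -(ler_nat F) [(_ * L.+1)%:R]natrM [(16 * D)%:R]natrM => ZL.
have D1 : 0 <= D%:R :> F by rewrite ler0n.
rewrite ler_pdivlMr // mulrDl.
(* [L + 1 <= 8 (i + 1) <= 16 (1 + i/2)], and [1 + i/2] is at most twice [s(q)] times the mass. The
   error term adds 16, whence 48. *)
have LG : L.+1%:R <= 32 * sum_inv_divisors F q * selberg_mass F q Z by lra.
move: (sum_inv_divisors F q) (selberg_mass F q Z) (L.+1%:R : F) (D%:R : F) G1 s1 L0 LG D1 ZL.
move=> s G l d G1 s1 l0 LG d0 ZL.
have G0 : 0 < G by lra.
have A : d / G * l <= 32 * s * d.
  rewrite mulrAC ler_pdivrMr //; have := ler_wpM2l d0 LG; lra.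
have B : 16 * d <= 16 * s * d by rewrite ler_wpM2r //; lra.
lra.
Qed.

End PrimesInProgressions.

(** * Divisor sums over dyadic blocks *)

Section DivisorSums.
Local Open Scope ring_scope.
Variable F : realFieldType.

(** If some [x] satisfies [P], all others lie in its class, that is, [m | d + (m - 1) x]. *)
Lemma card_congruent_le (lo n m : nat) (P : pred nat) : (0 < m)%N ->
  (forall x y : nat, P x -> P y -> x = y %[mod m]) ->
  ((\sum_(lo.+1 <= d < (lo + n).+1 | P d) 1) * m <= n + m)%N.
Proof.
move=> m0 H; case: (boolP (has P (index_iota lo.+1 (lo + n).+1))) => [/hasP[x _ Px]|/hasPn no].
  have [ub _] := card_dvd_shift_bounds lo n ((m - 1) * x) m0.
  apply: leq_trans ub; rewrite leq_mul2r; apply/orP; right.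
  rewrite big_mkcond [leqRHS]big_mkcond; apply: leq_sum => d _; case: ifP => // Pd.
  suff -> : (m %| d + (m - 1) * x)%N by [].
  rewrite /dvdn -modnDml (H _ _ Pd Px) modnDml.
  have -> : (x + (m - 1) * x = x * m)%N by case: (m) m0 => // m' _; rewrite subn1 /=; lia.
  by rewrite modnMl.
by rewrite big_seq_cond big1 ?mul0n // => d /andP[/no/negbTE ->].
Qed.

Definition tau (n : nat) : nat := (\sum_(1 <= f < n.+1 | (f %| n)%N) 1)%N.

Lemma card_coprime_multiples_le (a f k B : nat) : (0 < B)%N -> (0 < f)%N -> (0 < k)%N ->
  (\sum_(B <= b < 2 * B | coprime a b && (f %| a + b)%N && (k %| b)%N) 1)%N%:R
    <= B%:R / (f%:R * k%:R) + 1 :> F.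
Proof.
move=> B0 f0 k0; rewrite -natrM.
have fk0 : (0 < f * k)%N by rewrite muln_gt0 f0.
have E : (2 * B)%N = (B.-1 + B).+1 by lia.
rewrite E; have -> : \sum_(B <= b < (B.-1 + B).+1 | coprime a b && (f %| a + b)%N && (k %| b)%N) 1%N
   = \sum_(B.-1.+1 <= b < (B.-1 + B).+1 | coprime a b && (f %| a + b)%N && (k %| b)%N) 1%N.
  by rewrite prednK.
have fkF : (0 : F) < (f * k)%:R by rewrite ltr0n.
rewrite -(ler_pM2r fkF) mulrDl mul1r divfK ?gt_eqF // -natrM -natrD ler_nat.
apply: card_congruent_le => // x y /andP[/andP[cx fx] kx] /andP[/andP[cy fy] ky].
(* a common factor of f and k divides b and a + b, hence a, which is coprime to b *)
have cfk : coprime f k.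
  have gx := dvdn_trans (dvdn_gcdr f k) kx; have gax := dvdn_trans (dvdn_gcdl f k) fx.
  rewrite /coprime -dvdn1 -(eqP cx) dvdn_gcd gx andbT.
  by rewrite (dvdn_addl _ gx) in gax.
have l : lcmn f k = (f * k)%N by rewrite -muln_lcm_gcd (eqP cfk) muln1.
apply/eqP; rewrite -l eqn_mod_lcm; apply/andP; split.
  by rewrite -(eqn_modDl a); move: fx fy; rewrite /dvdn => /eqP -> /eqP ->.
by move: kx ky; rewrite /dvdn => /eqP -> /eqP ->.
Qed.

(** With [B = 2^i], [a <= b < 2B] lets both divisor sums be opened over [f <= 4B] and [k <= 2B]. At
    most [B / (f k) + 1] values of [b] meet the conditions; with weight [1/k] the sum over [k] is at
    most [2B / f + H(2B)], [H] being the harmonic sum, and the total [2B H(4B) + 4B H(2B)]. *)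
Lemma sum_tau_shifted_dyadic (a i : nat) : (0 < a)%N ->
  \sum_(2 ^ i <= b < 2 ^ i.+1 | coprime a b && (a <= b)%N)
     (tau (a + b))%:R * sum_inv_divisors F b <= 6 * (2 ^ i)%:R * (i + 3)%:R.
Proof.
move=> a0; rewrite expnS; set B := (2 ^ i)%N; have B0 : (0 < B)%N by rewrite expn_gt0.
have inv0 (k : nat) : 0 <= (k%:R^-1 : F) by rewrite invr_ge0 ler0n.
apply: (@le_trans _ _ (\sum_(1 <= f < (4 * B).+1) \sum_(1 <= k < (2 * B).+1) k%:R^-1 *
   (\sum_(B <= b < 2 * B | coprime a b && (f %| a + b)%N && (k %| b)%N) 1)%N%:R)).
  have -> : \sum_(1 <= f < (4 * B).+1) \sum_(1 <= k < (2 * B).+1) k%:R^-1 *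
   (\sum_(B <= b < 2 * B | coprime a b && (f %| a + b)%N && (k %| b)%N) 1)%N%:R
   = \sum_(B <= b < 2 * B | coprime a b) \sum_(1 <= f < (4 * B).+1 | (f %| a + b)%N)
       \sum_(1 <= k < (2 * B).+1 | (k %| b)%N) (k%:R^-1 : F).
    under [RHS]eq_bigr => b _ do rewrite big_mkcond.
    rewrite [RHS]exchange_big /=; apply: eq_bigr => f _.
    rewrite -big_mkcondr /=; under [RHS]eq_bigr => b _ do rewrite big_mkcond.
    rewrite [RHS]exchange_big /=; apply: eq_bigr => k _.
    rewrite -big_mkcondr /= natr_sum big_distrr /=; apply: eq_bigr => b _.
    by rewrite mulr1.
  rewrite big_nat_cond [leRHS]big_nat_cond big_mkcond [leRHS]big_mkcond.
  apply: ler_sum => b _; case: ifP; last first.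
    move=> _; case: ifP => // _; apply: sumr_ge0 => f _; exact: (sum_inv_ge0 _ _ _ id).
  case/andP => /andP[b1 b2] /andP[cab ab]; rewrite b1 b2 cab /=.
  rewrite (@sum_nat_widen_vanish _ (a + b)); first last.
  - by move=> k hk; apply/negbTE/negP => /dvdn_leq; lia.
  - by lia.
  rewrite /tau natr_sum big_distrl /=; apply: ler_sum => f _; rewrite mul1r.
  rewrite (@sum_nat_widen_vanish _ b (2 * B)) //; first exact: ltnW.
  by move=> k hk; apply/negbTE/negP => /dvdn_leq; lia.
apply: (@le_trans _ _ (\sum_(1 <= f < (4 * B).+1) (B%:R * f%:R^-1 * 2 + harmonic F (2 * B)))).
  apply: ler_sum_nat => f /andP[f0 _].
  apply: (@le_trans _ _ (\sum_(1 <= k < (2 * B).+1) (B%:R * f%:R^-1 * (k * k)%N%:R^-1 + k%:R^-1))).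
    apply: ler_sum_nat => k /andP[k0 _].
    apply: le_trans (ler_wpM2l (inv0 k) (card_coprime_multiples_le a B0 f0 k0)) _.
    by rewrite mulrDr mulr1 lerD2r natrM !invfM; apply: ler_of_eq; ring.
  rewrite big_split /= -big_distrr /= lerD2r ler_wpM2l ?sum_inv_sqr_le2 //.
  by rewrite mulr_ge0 ?ler0n.
rewrite big_split /= -big_distrl -big_distrr /= sumr_const_nat subSS subn0 -[X in _ + X]mulr_natl.
have h4 := harmonic_le_trunc_log F (4 * B); have h2 := harmonic_le_trunc_log F (2 * B).
have e2 : trunc_log 2 (2 * B) = i.+1 by rewrite -expnS trunc_expnK.
have e4 : trunc_log 2 (4 * B) = i.+2 by rewrite (_ : 4 = 2 * 2)%N // -mulnA -!expnS trunc_expnK.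
rewrite {}e2 in h2; rewrite {}e4 in h4; rewrite -/(harmonic F (4 * B)) natrM natrD.
have B1 : 0 <= B%:R :> F by rewrite ler0n.
move: h2 h4; rewrite -![_.+1%:R]natr1 => h2 h4.
have i0 : 0 <= i%:R :> F by rewrite ler0n.
have := ler_wpM2l B1 h2; have := ler_wpM2l B1 h4; nra.
Qed.

End DivisorSums.

(** * The sum over coprime pairs *)

Section MainSum.
Local Open Scope ring_scope.
Variable F : realFieldType.

Lemma ler_sum_subset (r1 r2 : seq nat) (P Q : pred nat) (f g : nat -> F) :
  uniq r1 -> uniq r2 ->
  (forall x : nat, x \in r1 -> P x -> [/\ x \in r2, Q x & f x <= g x]) ->
  (forall x : nat, x \in r2 -> Q x -> 0 <= g x) ->
  \sum_(x <- r1 | P x) f x <= \sum_(x <- r2 | Q x) g x.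
Proof.
move=> u1 u2 H g0; rewrite [leRHS](bigID (fun x => (x \in r1) && P x)) /= -[leLHS]addr0.
apply: lerD; last first.
  by rewrite big_seq_cond; apply: sumr_ge0 => x /andP[x2 /andP[Qx _]]; apply: g0.
rewrite -[leRHS]big_filter.
have pe : perm_eq [seq x <- r1 | P x] [seq x <- r2 | Q x && ((x \in r1) && P x)].
  apply: uniq_perm; rewrite ?filter_uniq // => x; rewrite !mem_filter.
  apply/andP/andP => [[Px x1]|[/and3P[Qx x1 Px] _]] //.
  by case: (H x x1 Px) => x2 Qx _; rewrite Px x1 Qx x2.
rewrite (_ : \sum_(x <- [seq x <- r2 | _]) g x = \sum_(x <- [seq x <- r1 | P x]) g x).
  rewrite big_filter [leLHS]big_seq_cond [leRHS]big_seq_cond.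
  by apply: ler_sum => x /andP[x1 Px]; case: (H x x1 Px).
by apply: perm_big; rewrite perm_sym.
Qed.

(** The cutoff for [d] comes from [f <= a + b <= 2 a b]: then [4 a b d - f <= N] forces
    [2 a b d <= N]. *)
Definition pair_count (N a b : nat) : nat :=
  (\sum_(1 <= f < (a + b).+1 | (f %| a + b)%N) prime_count (4 * a * b) f (N %/ (2 * a * b)))%N.

Lemma pair_countC (N a b : nat) : pair_count N a b = pair_count N b a.
Proof. by rewrite /pair_count addnC ![(_ * a * b)%N]mulnAC. Qed.

Lemma sum_inv_divisors4 : sum_inv_divisors F 4 <= 2.
Proof. by rewrite /sum_inv_divisors unlock /= invr1; lra. Qed.

(** Each of the [tau (a + b)] values of [f] gets the same sieve bound. The 2 from [s(4) = 7/4 <= 2]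
    cancels against the one in [N / (2 a b)]. *)
Lemma pair_count_le (N a b : nat) : (0 < a)%N -> (0 < b)%N -> (2 * a * b <= N)%N ->
  (pair_count N a b)%:R <= 48 * (tau (a + b))%:R
     * (sum_inv_divisors F a * sum_inv_divisors F b)
     * (N%:R / (a%:R * b%:R)) / (trunc_log 2 (N %/ (2 * a * b))).+1%:R.
Proof.
move=> a0 b0 abN; set D := (N %/ _)%N.
have ab0 : (0 < 2 * a * b)%N by rewrite !muln_gt0 a0.
have D0 : (0 < D)%N by rewrite divn_gt0.
set c := 48 * _ * _ * _ / _.
have cE : c = (tau (a + b))%:R * (48 * (sum_inv_divisors F a * sum_inv_divisors F b)
     * (N%:R / (a%:R * b%:R)) / (trunc_log 2 D).+1%:R) by rewrite /c; ring.
rewrite {}cE /pair_count /tau !natr_sum big_distrl /=.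
rewrite big_nat_cond [leRHS]big_nat_cond; apply: ler_sum => f /andP[/andP[f0 fab] fd].
rewrite mul1r.
have q0 : (0 < 4 * a * b)%N by rewrite !muln_gt0 a0.
have fq : (2 * f <= 4 * a * b)%N by nia.
apply: le_trans (prime_count_le F D0 q0 fq) _.
rewrite ler_wpM2r ?invr_ge0 ?ler0n //.
have s1 : sum_inv_divisors F (4 * a * b) <= 2 * (sum_inv_divisors F a * sum_inv_divisors F b).
  rewrite -mulnA; apply: le_trans (sum_inv_divisorsM F _ _) _; rewrite ?muln_gt0 ?a0 //.
  apply: ler_pM; rewrite ?(sum_inv_ge0 _ _ _ id) ?sum_inv_divisors4 //.
  exact: sum_inv_divisorsM.
have D1 : D%:R <= N%:R / (a%:R * b%:R) / 2 :> F.
  rewrite -mulrA -invfM ler_pdivlMr -?natrM ?ltr0n ?muln_gt0 ?a0 ?b0 // ler_nat.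
  by rewrite (_ : a * b * 2 = 2 * a * b)%N ?leq_divM //; lia.
have sab : 0 <= sum_inv_divisors F a * sum_inv_divisors F b.
  by rewrite mulr_ge0 ?(sum_inv_ge0 _ _ _ id).
apply: (@le_trans _ _ (48 * (2 * (sum_inv_divisors F a * sum_inv_divisors F b)) * (N%:R / (a%:R * b%:R) / 2))).
  by apply: ler_pM; rewrite ?mulr_ge0 ?ler0n ?(sum_inv_ge0 _ _ _ id) // ler_wpM2l.
apply: ler_of_eq.
by move: (N%:R / _) => x; field.
Qed.

(** Rounding costs at most 1 in the difference of the logarithms; the factor 2 absorbs it. *)
Lemma trunc_log_quotient (M b : nat) : (0 < b <= M)%N ->
  ((trunc_log 2 M - trunc_log 2 b).+1 <= 2 * (trunc_log 2 (M %/ b)).+1)%N.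
Proof.
move=> /andP[b0 bM]; set L := trunc_log 2 M; set i := trunc_log 2 b.
have iL : (i <= L)%N by apply: leq_trunc_log.
case: (ltnP i L) => [iL'|]; last by lia.
suff : (L - i.+1 <= trunc_log 2 (M %/ b))%N by lia.
apply: trunc_log_max => //; rewrite leq_divRL //.
apply: leq_trans (trunc_logP (isT : 1 < 2)%N (leq_trans b0 bM)); rewrite -/L.
apply: (@leq_trans (2 ^ (L - i.+1) * 2 ^ i.+1)%N); last by rewrite -expnD subnK.
by rewrite leq_mul2l ltnW ?orbT // trunc_log_ltn.
Qed.

Lemma sum_dyadic_weights_le (L : nat) :
  \sum_(0 <= i < L.+1) ((i + 3)%:R / (L - i).+1%:R : F) <= (L + 3)%:R * harmonic F L.+1.
Proof.
rewrite big_nat_rev /= add0n /harmonic big_add1 big_distrr /=.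
apply: ler_sum_nat => i /andP[_ iL]; rewrite subSS subKn; last by lia.
by rewrite ler_wpM2r ?invr_ge0 ?ler0n // ler_nat; lia.
Qed.

(** Sort [b] by its binary logarithm [i]: there [1/b <= 1/2^i] and the sieve denominator is at least
    [(L - i + 1) / 2], so the block estimate applies. The constants are [96 = 2 * 48],
    [576 = 6 * 96] and [1728 = 3 * 576]. *)
Lemma sum_pair_count_row_le (N a : nat) : (0 < a)%N ->
  \sum_(1 <= b < N.+1 | coprime a b && (a <= b)%N && (2 * a * b <= N)%N) (pair_count N a b)%:R
   <= 1728 * (trunc_log 2 N).+1%:R * harmonic F (trunc_log 2 N).+1 * N%:R
        * (sum_inv_divisors F a / a%:R).
Proof.
move=> a0; set M := (N %/ (2 * a))%N; set L := trunc_log 2 M; set s := sum_inv_divisors F a.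
have LN : (L <= trunc_log 2 N)%N by apply: leq_trunc_log; apply: leq_div.
have s0 : 0 <= s by apply: (sum_inv_ge0 _ _ _ id).
have aF : (0 : F) < a%:R by rewrite ltr0n.
have c0 : 0 <= s * N%:R / a%:R by rewrite !mulr_ge0 ?invr_ge0 ?ler0n.
apply: (@le_trans _ _ (\sum_(0 <= i < L.+1) \sum_(2 ^ i <= b < 2 ^ i.+1 | coprime a b && (a <= b)%N)
    (96 * (s * N%:R / a%:R) * ((2 ^ i)%:R^-1 / (L - i).+1%:R))
       * ((tau (a + b))%:R * sum_inv_divisors F b))).
  apply: (@le_trans _ _ (\sum_(0 <= i < L.+1)
     \sum_(1 <= b < N.+1 | coprime a b && (a <= b)%N && (2 * a * b <= N)%N)
       if trunc_log 2 b == i then (pair_count N a b)%:R else 0)).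
    rewrite exchange_big /= big_nat_cond [leRHS]big_nat_cond; apply: ler_sum => b.
    move=> /andP[/andP[b0 bN] /andP[_ abN]].
    have bM : (b <= M)%N by rewrite leq_divRL ?muln_gt0 ?a0 // mulnC.
    have bL : (trunc_log 2 b < L.+1)%N by rewrite ltnS leq_trunc_log.
    rewrite (bigD1_seq (trunc_log 2 b)) ?mem_index_iota ?iota_uniq //= eqxx lerDl.
    by apply: sumr_ge0 => j _; case: ifP.
  apply: ler_sum_nat => i /andP[_ iL].
  rewrite -big_mkcondr /=; apply: ler_sum_subset; rewrite ?iota_uniq //; last first.
    move=> b _ _; rewrite !mulr_ge0 ?invr_ge0 ?ler0n //; exact: (sum_inv_ge0 _ _ _ id).
  move=> b; rewrite !mem_index_iota => /andP[b0 bN] /andP[/andP[/andP[cab ab] abN] /eqP bi].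
  rewrite -{1 2}bi trunc_log_ltn // trunc_logP // cab ab; split=> //.
  apply: le_trans (pair_count_le a0 b0 abN) _.
  have bM : (0 < b <= M)%N by rewrite b0 leq_divRL ?muln_gt0 ?a0 // mulnC.
  (* Composing the integer divisions, [M / b] is the cutoff [N / (2 a b)]. *)
  have := trunc_log_quotient bM; rewrite -/L bi /M -divnMA -(ler_nat F) natrM.
  set t := (trunc_log 2 _).+1%:R => tL.
  have t0 : 0 < t by rewrite ltr0n.
  have l0 : (0 : F) < (L - i).+1%:R by rewrite ltr0n.
  have p0 : (0 : F) < (2 ^ i)%:R by rewrite ltr0n expn_gt0.
  have bF : (0 : F) < b%:R by rewrite ltr0n.
  have w0 : 0 <= (tau (a + b))%:R * sum_inv_divisors F b.
    by rewrite mulr_ge0 ?ler0n ?(sum_inv_ge0 _ _ _ id).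
  have e1 : t^-1 <= 2 / (L - i).+1%:R by rewrite ler_pdivlMr // mulrC ler_pdivrMr.
  have e2 : b%:R^-1 <= (2 ^ i)%:R^-1 :> F.
    by rewrite lef_pV2 ?posrE // ler_nat -bi trunc_logP.
  have e3 : b%:R^-1 * t^-1 <= (2 ^ i)%:R^-1 * (2 / (L - i).+1%:R).
    by apply: ler_pM => //; rewrite invr_ge0 ltW.
  have cw : 0 <= 48 * (s * N%:R / a%:R) * ((tau (a + b))%:R * sum_inv_divisors F b).
    by rewrite !mulr_ge0 ?invr_ge0 ?ler0n ?(sum_inv_ge0 _ _ _ id).
  have := ler_wpM2l cw e3.
  have -> : 48 * (s * N%:R / a%:R) * ((tau (a + b))%:R * sum_inv_divisors F b) * (b%:R^-1 / t)
    = 48 * (tau (a + b))%:R * (s * sum_inv_divisors F b) * (N%:R / (a%:R * b%:R)) / t.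
    by rewrite [(a%:R * b%:R)^-1]invfM; ring.
  move=> H; apply: le_trans H _.
  apply: ler_of_eq; ring.
apply: (@le_trans _ _ (\sum_(0 <= i < L.+1) 576 * (s * N%:R / a%:R) * ((i + 3)%:R / (L - i).+1%:R))).
  apply: ler_sum_nat => i _; rewrite -big_distrr /=.
  have p0 : (0 : F) < (2 ^ i)%:R by rewrite ltr0n expn_gt0.
  have l0 : (0 : F) < (L - i).+1%:R by rewrite ltr0n.
  have cc : 0 <= 96 * (s * N%:R / a%:R) * ((2 ^ i)%:R^-1 / (L - i).+1%:R).
    by rewrite !mulr_ge0 ?invr_ge0 ?ler0n.
  apply: le_trans (ler_wpM2l cc (sum_tau_shifted_dyadic F i a0)) _.
  apply: ler_of_eq.
  by field; rewrite addrC natr1 !gt_eqF.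
rewrite -big_distrr /=.
apply: (@le_trans _ _ (576 * (s * N%:R / a%:R) * (3 * (trunc_log 2 N).+1%:R * harmonic F (trunc_log 2 N).+1))).
  apply: ler_wpM2l; first by rewrite pmulr_rge0 //.
  apply: le_trans (sum_dyadic_weights_le _) _.
  apply: ler_pM; rewrite ?ler0n ?(sum_inv_ge0 _ _ _ id) //; last by apply: harmonic_le.
  by rewrite -natrM ler_nat; lia.
apply: ler_of_eq; ring.
Qed.

(** By symmetry the sum is at most twice the half with [a <= b]; [6912 = 2 * 1728 * 2], the last 2
    coming from the sum of [s(a) / a]. *)
Lemma sum_pair_count_le (N : nat) :
  ((\sum_(1 <= a < N.+1) \sum_(1 <= b < N.+1 | coprime a b && (2 * a * b <= N)%N)
     pair_count N a b)%N%:R : F)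
  <= 6912 * N%:R * (trunc_log 2 N).+1%:R ^+ 2 * (trunc_log 2 (trunc_log 2 N).+1).+1%:R.
Proof.
set l := (trunc_log 2 N).+1.
pose T := (\sum_(1 <= a < N.+1) \sum_(1 <= b < N.+1 | coprime a b && (a <= b)%N && (2 * a * b <= N)%N)
     pair_count N a b)%N.
apply: (@le_trans _ _ (T%:R + T%:R)).
  rewrite -natrD ler_nat {2}/T.
  under [X in (_ <= _ + X)%N]eq_bigr => a _ do rewrite big_mkcond.
  rewrite [X in (_ <= _ + X)%N]exchange_big /= /T -big_split /=; apply: leq_sum => a _.
  rewrite big_mkcond [X in (_ <= X + _)%N]big_mkcond -big_split /=; apply: leq_sum => b _.
  rewrite [coprime b a]coprime_sym [(2 * b * a)%N]mulnAC pair_countC.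
  by case: (coprime a b); case: (_ <= N)%N; case: (leqP a b) => //= h; rewrite ?addn0 ?add0n ?leq_addr // (ltnW h).
have TB : T%:R <= 1728 * l%:R * harmonic F l * N%:R * (2 * harmonic F N).
  rewrite natr_sum; apply: le_trans (ler_wpM2l _ (sum_inv_divisors_avg F N)); last first.
    by rewrite !mulr_ge0 ?ler0n ?(sum_inv_ge0 _ _ _ id).
  rewrite big_distrr /=; apply: ler_sum_nat => a /andP[a0 _].
  by rewrite natr_sum; apply: sum_pair_count_row_le.
apply: (@le_trans _ _ (2 * (1728 * l%:R * (trunc_log 2 l).+1%:R * N%:R * (2 * l%:R)))).
  rewrite -mulr2n -[leLHS]mulr_natl ler_wpM2l //; apply: le_trans TB _.
  apply: ler_pM; rewrite ?mulr_ge0 ?ler0n ?(sum_inv_ge0 _ _ _ id) //.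
    by rewrite ler_wpM2r ?ler0n // ler_wpM2l ?mulr_ge0 ?ler0n // harmonic_le_trunc_log.
  by rewrite ler_wpM2l // harmonic_le_trunc_log.
apply: ler_of_eq; ring.
Qed.

End MainSum.

(** * Parametrization of the solutions *)

Section Parametrization.
Local Open Scope nat_scope.

(** The equation is that of the denominators [m], [p u], [p v]. Removing the gcd of [u] and [v],
    then [a b] from [m], then [d] from the gcd, leaves [4 a b d e = p e + (a + b)], so
    [e | a + b]. *)
Lemma solution_params (p m u v : nat) : prime p -> ~~ (p %| m) ->
  0 < m -> 0 < u -> 0 < v -> 4 * m * u * v = p * u * v + m * u + m * v ->
  exists a b d e f : nat, [/\ coprime a b, a + b = e * f, 4 * a * b * d = p + f,
    [/\ 0 < a, 0 < b, 0 < d & 0 < f] & [/\ m = a * b * d, u = e * d * a & v = e * d * b]].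
Proof.
move=> pp pm m0 u0 v0 E; pose g := gcdn u v.
have g0 : 0 < g by rewrite gcdn_gt0 u0.
have [[a ua] [b vb]] := (dvdnP (dvdn_gcdl u v), dvdnP (dvdn_gcdr u v)).
rewrite -/g in ua vb.
have a0 : 0 < a by move: u0; rewrite ua muln_gt0 => /andP[].
have b0 : 0 < b by move: v0; rewrite vb muln_gt0 => /andP[].
have cab : coprime a b by rewrite /coprime -(eqn_pmul2r g0) muln_gcdl -ua -vb mul1n.
have E1 : 4 * m * g * (a * b) = p * g * (a * b) + m * (a + b).
  by apply/eqP; rewrite -(eqn_pmul2r g0); apply/eqP; move: E; rewrite ua vb; nia.
(* [a b] divides [m (a + b)] and is prime to [a + b]. *)
have abm : a * b %| m.
  rewrite -(@Gauss_dvdl (a * b) m (a + b)).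
    by have := dvdn_mull (4 * m * g) (dvdnn (a * b)); rewrite E1 dvdn_addr // dvdn_mull.
  by rewrite coprimeMl /coprime gcdnDr addnC gcdnDr -!/(coprime _ _) cab coprime_sym.
have [d md] := dvdnP abm.
have d0 : 0 < d by move: m0; rewrite md muln_gt0 => /andP[].
have E2 : 4 * (a * b) * d * g = p * g + d * (a + b).
  by apply/eqP; rewrite -(@eqn_pmul2r (a * b)) ?muln_gt0 ?a0 //; apply/eqP; move: E1; rewrite md; nia.
(* [d] divides [p g] and, being a divisor of [m], is prime to [p]. *)
have dg : d %| g.
  rewrite -(@Gauss_dvdr d p g).
    by have := dvdn_mulr g (dvdn_mull (4 * (a * b)) (dvdnn d)); rewrite E2 dvdn_addl // dvdn_mulr.
  by rewrite coprime_sym prime_coprime //; apply: contra pm => pd; rewrite md dvdn_mulr.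
have [e ge] := dvdnP dg.
have e0 : 0 < e by move: g0; rewrite ge muln_gt0 => /andP[].
have E3 : 4 * (a * b) * d * e = p * e + (a + b).
  by apply/eqP; rewrite -(eqn_pmul2r d0); apply/eqP; move: E2; rewrite ge; nia.
have eab : e %| a + b by have := dvdn_mull (4 * (a * b) * d) (dvdnn e); rewrite E3 dvdn_addr // dvdn_mull.
have [f fE] := dvdnP eab.
exists a, b, d, e, f; split=> //; first by rewrite fE mulnC.
- by apply/eqP; rewrite -(eqn_pmul2r e0) mulnDl -fE -E3 !mulnA.
- have : 0 < f * e by rewrite -fE addn_gt0 a0.
  by rewrite muln_gt0 => /andP[f0 _].
- by rewrite md ua vb ge ![(_ * (e * d))%N]mulnC [d * _]mulnC.
Qed.

(** [e] is left out, being [(a + b) / f]; the nesting follows the order of summation in the sum over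
    pairs. *)
Definition param_list (N p : nat) : seq (nat * (nat * (nat * nat))) :=
  [seq (a, y) | a <- index_iota 1 N.+1, y <-
    [seq (b, z) | b <- [seq b <- index_iota 1 N.+1 | coprime a b && (2 * a * b <= N)], z <-
      [seq (f, d) | f <- [seq f <- index_iota 1 (a + b).+1 | f %| a + b],
         d <- [seq d <- index_iota 1 (N %/ (2 * a * b)).+1 | 4 * a * b * d - f == p]]]].

Lemma size_param_list (N p : nat) : size (param_list N p) =
  \sum_(1 <= a < N.+1) \sum_(1 <= b < N.+1 | coprime a b && (2 * a * b <= N))
    \sum_(1 <= f < (a + b).+1 | f %| a + b)
      \sum_(1 <= d < (N %/ (2 * a * b)).+1 | 4 * a * b * d - f == p) 1.
Proof.
rewrite size_allpairs_dep sumnE big_map; apply: eq_bigr => a _.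
rewrite size_allpairs_dep sumnE big_map big_filter; apply: eq_bigr => b _.
rewrite size_allpairs_dep sumnE big_map big_filter; apply: eq_bigr => f _.
by rewrite size_filter sum1_count.
Qed.

Lemma mem_param_list (N p a b d f : nat) : p <= N -> coprime a b -> f %| a + b ->
  4 * a * b * d = p + f -> 0 < a -> 0 < b -> 0 < d -> 0 < f ->
  (a, (b, (f, d))) \in param_list N p.
Proof.
move=> pN cab fab E a0 b0 d0 f0.
have fle : f <= a + b by apply: dvdn_leq => //; rewrite addn_gt0 a0.
have ab0 : 0 < a * b by rewrite muln_gt0 a0.
have sab : a + b <= 2 * (a * b) by nia.
have dab : a * b <= a * b * d by rewrite leq_pmulr.
have dN : d * (2 * a * b) <= N by lia.
have abN : 2 * a * b <= N by lia.
have aN : a < N.+1 by nia.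
have bN : b < N.+1 by nia.
apply/allpairsPdep; exists a, (b, (f, d)); split=> //; first by rewrite mem_index_iota a0.
apply/allpairsPdep; exists b, (f, d); split=> //; first by rewrite mem_filter cab abN mem_index_iota b0.
apply/allpairsPdep; exists f, d; split=> //; first by rewrite mem_filter fab mem_index_iota f0 ltnS.
by rewrite mem_filter E addnK eqxx mem_index_iota d0 ltnS leq_divRL // !muln_gt0 a0.
Qed.

(* The index [i] is the position of the denominator that [p] does not divide. *)
Definition solution_of_params (p i : nat) (t : nat * (nat * (nat * nat))) : nat * nat * nat :=
  let: (a, (b, (f, d))) := t in
  let e := (a + b) %/ f in
  let m := a * b * d in let u := p * (e * d * a) in let v := p * (e * d * b) in
  match i with 0 => (m, u, v) | 1 => (u, m, v) | _ => (u, v, m) end.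

(** The list lies in the union of three images of the parameters, one for each position of the
    denominator prime to [p]. *)
Lemma count_le_param_list (N p : nat) (l : seq (nat * nat * nat)) :
  (forall n1 n2 n3 : nat, (n1, n2, n3) \in l -> exists i t,
     i < 3 /\ t \in param_list N p /\ (n1, n2, n3) = solution_of_params p i t) ->
  uniq l -> size l <= 3 * size (param_list N p).
Proof.
move=> H u.
have -> : 3 * size (param_list N p)
   = size [seq solution_of_params p i t | i <- [:: 0; 1; 2], t <- param_list N p].
  by rewrite size_allpairs.
apply: uniq_leq_size => // -[[n1 n2] n3] /H [i [t [i3 [tp ->]]]].
by apply/allpairsP; exists (i, t); split=> //=; case: i i3 => [|[|[|]]].
Qed.

(** With the sum over [p] moved innermost, each [(a, b, f, d)] is counted for at most one prime,
    [4 a b d - f]. *)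
Lemma sum_size_param_list (N : nat) :
  \sum_(0 <= p < N.+1 | prime p) size (param_list N p)
   <= \sum_(1 <= a < N.+1) \sum_(1 <= b < N.+1 | coprime a b && (2 * a * b <= N))
        pair_count N a b.
Proof.
under eq_bigr => p _ do rewrite size_param_list.
rewrite exchange_big /=; apply: leq_sum => a _.
rewrite exchange_big /=; apply: leq_sum => b _.
rewrite exchange_big /=; apply: leq_sum => f _.
under eq_bigr => p _ do rewrite big_mkcond.
rewrite exchange_big /= /prime_count [leqRHS]big_mkcond; apply: leq_sum => d _.
set n := _ - f; rewrite -big_mkcondr /=.
case: (boolP (prime n)) => [pn|npn]; last first.
  by rewrite big1 // => p /andP[pp /eqP E]; rewrite E pp in npn.
apply: (@leq_trans (\sum_(0 <= p < N.+1 | p == n) 1)).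
  by rewrite big_mkcond [leqRHS]big_mkcond; apply: leq_sum => p _; rewrite eq_sym; case: ifP => // /andP[_ ->].
rewrite sum1_count; apply: leq_trans (leq_b1 (n \in index_iota 0 N.+1)).
by rewrite -(count_uniq_mem _ (iota_uniq _ _)).
Qed.

End Parametrization.

(** * Transfer to the counting function and to real numbers *)

Section Counting.

Lemma nat_primeP (p : nat) : nat_prime p -> prime p.
Proof.
move=> pp; have p1 := prime_ge_2 _ pp; apply/primeP; split; first by lia.
move=> d /dvdnP[k E].
have dp : Z.divide (Z.of_nat d) (Z.of_nat p) by exists (Z.of_nat k); lia.
by case: (prime_divisors _ pp _ dp) => [|[|[|]]] H; lia.
Qed.

Lemma prime_nat_prime (p : nat) : prime p -> nat_prime p.
Proof.
move=> /primeP[p1 pd]; apply: (proj1 (prime_alt _)); split; first by lia.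
move=> n n1 [k E].
have n0 : Z.le Z0 n by lia.
have /orP[/eqP H|/eqP H] : xpred2 1%N p (Z.to_nat n).
- apply: pd; apply/dvdnP; exists (Z.to_nat k).
  have k0 : Z.le Z0 k by nia.
  by apply: Nat2Z.inj; rewrite -multE Nat2Z.inj_mul !Z2Nat.id.
- by lia.
- by lia.
Qed.

Lemma divb_prime (p n : nat) : divb p n = (p %| n)%N :> nat.
Proof.
rewrite /divb; case: Nat.eqb_spec => [|] H.
  case: p H => [|p] H; first by rewrite /= in H; rewrite H.
  have -> : (p.+1 %| n)%N; last by [].
  by apply/dvdnP; exists (Nat.div n p.+1); have := Nat.div_mod_eq n p.+1; lia.
suff /negbTE -> : ~~ (p %| n)%N by [].
apply/negP => /dvdnP[k E]; apply: H; rewrite E; exact: PeanoNat.Nat.Div0.mod_mul.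
Qed.

Lemma solution_in_params (N p n1 n2 n3 : nat) : prime p -> (p <= N)%N ->
  is_sol_i 2 p (n1, n2, n3) -> exists i t,
    (i < 3)%N /\ t \in param_list N p /\ (n1, n2, n3) = solution_of_params p i t.
Proof.
move=> pp pN [sol]; rewrite !divb_prime => div2.
have p0 := prime_gt0 pp.
have E := @is_sol_nat p n1 n2 n3 (ssrnat.ltP p0) sol.
have [/ssrnat.ltP h1 [/ssrnat.ltP h2 [/ssrnat.ltP h3 _]]] := sol.
(* One parameter tuple serves every position [i], so the three cases below differ only by a
   permutation. *)
have main (m u v : nat) : ~~ (p %| m)%N -> (0 < m)%N -> (0 < p * u)%N -> (0 < p * v)%N ->
   (4 * (m * (p * u) * (p * v)) = p * ((p * u) * (p * v) + m * (p * v) + m * (p * u)))%N ->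
   exists t, t \in param_list N p /\ forall i, solution_of_params p i t =
      match i with 0 => (m, p * u, p * v) | 1 => (p * u, m, p * v) | _ => (p * u, p * v, m) end%N.
  move=> pm m0; rewrite !muln_gt0 p0 /= => u0 v0 Em.
  have [|a [b [d [e [f [cab fab Ep [a0 b0 d0 f0] [-> -> ->]]]]]]] := solution_params pp pm m0 u0 v0.
    by apply/eqP; rewrite -(@eqn_pmul2r (p * p)) ?muln_gt0 ?p0 //; apply/eqP; nia.
  exists (a, (b, (f, d))); split; first by apply: mem_param_list; rewrite // fab dvdn_mull.
  by move=> i; rewrite /= fab mulnK.
case d1: (p %| n1)%N div2; case d2: (p %| n2)%N; case d3: (p %| n3)%N => //= _.
- have [[x Ex] [y Ey]] := (dvdnP d1, dvdnP d2).
  rewrite mulnC in Ex; rewrite mulnC in Ey; subst n1 n2.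
  have [|t [tp H]] := main n3 x y (negbT d3) h3 h1 h2; first by rewrite !multE !plusE in E; lia.
  by exists 2%N, t; rewrite H.
- have [[x Ex] [y Ey]] := (dvdnP d1, dvdnP d3).
  rewrite mulnC in Ex; rewrite mulnC in Ey; subst n1 n3.
  have [|t [tp H]] := main n2 x y (negbT d2) h2 h1 h3; first by rewrite !multE !plusE in E; lia.
  by exists 1%N, t; rewrite H.
- have [[x Ex] [y Ey]] := (dvdnP d2, dvdnP d3).
  rewrite mulnC in Ex; rewrite mulnC in Ey; subst n2 n3.
  have [|t [tp H]] := main n1 x y (negbT d1) h1 h2 h3; first by rewrite !multE !plusE in E; lia.
  by exists 0%N, t; rewrite H.
Qed.

Lemma uniq_NoDup (T : eqType) (s : seq T) : List.NoDup s -> uniq s.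
Proof.
elim: s => //= x s IH nd; inversion nd as [|y s' nin nds]; subst.
rewrite IH // andbT; apply/negP => xs; apply: nin; move: xs; clear.
by elim: s => //= y s IH; rewrite inE => /orP[/eqP ->|/IH]; [left|right].
Qed.

Lemma count_f2_le (N p c : nat) : prime p -> (p <= N)%N -> is_count_f 2 p c ->
  (c <= 3 * size (param_list N p))%N.
Proof.
move=> pp pN [l [nd [lP <-]]]; apply: count_le_param_list; last exact: uniq_NoDup.
move=> n1 n2 n3 tl; apply: solution_in_params => //; apply/lP.
by move: tl; clear; elim: l => //= y s IH; rewrite inE => /orP[/eqP ->|/IH]; [left|right].
Qed.

(** The estimate over ordered fields is used over the rationals, and [12^4 = 3 * 6912]. *)
Lemma sum_f2_le (N : nat) (f2 : nat -> nat) :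
  (forall p : nat, nat_prime p -> is_count_f 2 p (f2 p)) ->
  (\sum_(0 <= p < N.+1 | prime p) f2 p
    <= 12 ^ 4 * N * (trunc_log 2 N).+1 ^ 2 * (trunc_log 2 (trunc_log 2 N).+1).+1)%N.
Proof.
move=> H; set l := (trunc_log 2 N).+1.
apply: (@leq_trans (3 * \sum_(0 <= p < N.+1 | prime p) size (param_list N p)))%N.
  rewrite big_distrr /= big_nat_cond [leqRHS]big_nat_cond.
  apply: leq_sum => p /andP[/andP[_ pN] pp].
  by apply: count_f2_le => //; apply/H/prime_nat_prime.
have := leq_mul (leqnn 3) (sum_size_param_list N) => /leq_trans; apply.
move: (sum_pair_count_le rat N); rewrite -/l => H1.
rewrite -(ler_nat rat) [(3 * _)%:R%R]natrM 3!natrM 2!natrX.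
move: H1; set t := (\sum_(_ <= _ < _) _)%N; move: (t%:R)%R (N%:R)%R (l%:R)%R ((trunc_log 2 l).+1%:R)%R => t' n l' k. lra.
Qed.
End Counting.

(* ssreflect's boolean [if] would coerce [prime_dec] to [bool]. *)
Open Scope general_if_scope.

Lemma sum_f_R0_prime (f2 : nat -> nat) (N : nat) :
  sum_f_R0 (fun p => if Z.ltb 1 (Z.of_nat p) then
                       (if Znumtheory.prime_dec (Z.of_nat p) then INR (f2 p) else 0)
                     else 0) N
  = INR (\sum_(0 <= p < N.+1 | prime p) f2 p)%N.
Proof.
set g := (fun p : nat => _ : R).
have gE p : g p = INR (if prime p then f2 p else 0%N).
  rewrite /g; case: Znumtheory.prime_dec => [pp|npp].
    rewrite nat_primeP //; case: Z.ltb_spec => // h.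
    by have := prime_ge_2 _ pp; lia.
  case: (boolP (prime p)) => [/prime_nat_prime //|_].
  by case: ifP.
rewrite [in RHS]big_mkcond; elim: N => [|N IH]; first by rewrite big_nat1 /= gE.
by rewrite big_nat_recr //= IH gE -plusE plus_INR.
Qed.

(* f2 : nat -> nat is any function agreeing with f_2(p) = #solutions with exactly two
   denominators divisible by p, at every prime p (is_count_f 2 p (f2 p)). *)
Theorem mainTheorem1 :
  exists C x0 : R, 0 < C /\ 0 < x0 /\
    forall (f2 : nat -> nat),
      (forall p : nat, nat_prime p -> is_count_f 2 p (f2 p)) ->
      forall x : R, x0 <= x ->
        forall N : nat, INR N < x -> x <= INR N + 1 ->
          sum_f_R0 (fun p => if Z.ltb 1 (Z.of_nat p) then
                               (if Znumtheory.prime_dec (Z.of_nat p) then INR (f2 p) else 0)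
                             else 0) N
          <= C * x * (ln x) ^ 2 * ln (ln x).
Proof.
(* 63 is the price of natural logarithms, [12^4] the constant of the integer bound. *)
exists (63 * INR (12 ^ 4)), (exp (exp 1)).
split; first by apply: Rmult_lt_0_compat; [Lra.lra | apply: lt_0_INR; lia].
split; first exact: exp_pos.
move=> f2 H x hx N Nx xN; rewrite sum_f_R0_prime.
(* [N = 0] would give [x <= 1 < e^e]; positivity gives [2 ^ trunc_log 2 N <= N]. *)
have N0 : (0 < N)%N.
  rewrite lt0n; apply/eqP => N0; rewrite N0 /= in xN.
  have := exp_ineq1 1; have := exp_ineq1 (exp 1); Lra.lra.
have pow_INR' m k : INR (m ^ k)%N = INR m ^ k.
  by elim: k => [|k IH] //; rewrite expnS -multE mult_INR IH.
apply: (@log_growth_bound _ N (trunc_log 2 N) (trunc_log 2 (trunc_log 2 N).+1)) => //.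
- exact: pos_INR.
- rewrite -[2]/(INR 2) -pow_INR'; apply: le_INR; apply/ssrnat.leP.
  exact: trunc_logP.
- rewrite -[2]/(INR 2) -pow_INR' -S_INR; apply: le_INR; apply/ssrnat.leP.
  exact: trunc_logP.
- rewrite -!S_INR -pow_INR' -!mult_INR; apply: le_INR; apply/ssrnat.leP.
  exact: sum_f2_le.
Qed.
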